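(* Let $g$ be an asymptotically flat axisymmetric metric which is everywhere radially monotone. Then $g$ is everywhere area enlarging.
   Context: An axisymmetric metric is a smooth Riemannian metric $g$ given in global cylindrical coordinates $(\rho,z,\phi)$ by $g=e^{2\alpha-2u}(d\rho^2+dz^2)+\rho^2e^{-2u}(d\phi+B\,d\rho+A\,dz)^2$, where $\alpha,u,A,B$ depend only on $(\rho,z)$; its Killing field is $\eta=\partial/\partial\phi$. Asymptotic flatness means here that, for $r=\sqrt{\rho^2+z^2}$ large, $|\partial^I u|,|\partial^I\alpha|,|\partial^I A|,|\partial^I B|\le C/r^{1+|I|}$ for some constant $C$ and multi-indices $|I|\le2$; in particular $u,\alpha\to0$ at infinity. Radially monotone everywhere: $\frac{\partial}{\partial\rho}\Big(\frac1\rho\frac{|\eta|_g}{|\nabla\rho|_g}\Big)\le0$ for all $\rho>0$ and $z$; equivalently $\partial_\rho(\alpha-2u)\le 0$. Area enlarging everywhere: $\frac{|\eta|_g}{|\nabla\rho|_g}(\rho,z)\ge\rho$ for all $\rho>0$ and $z$; equivalently $\alpha-2u\ge0$. *)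

(* Defs.v *)
From HB Require Import structures.
From mathcomp Require Import all_boot all_order all_algebra.
From mathcomp Require Import all_classical all_reals all_analysis.

Set Implicit Arguments.
Unset Strict Implicit.
Unset Printing Implicit Defensive.

Import Order.TTheory GRing.Theory Num.Theory.
Import numFieldNormedType.Exports.
Local Open Scope classical_set_scope.
Local Open Scope ring_scope.

Definition partial (R : realType) (n : nat) (i : 'I_n.+1)
    (f : 'rV[R]_n.+1 -> R) : 'rV[R]_n.+1 -> R :=
  fun p => 'D_(delta_mx 0 i) f p.

(* C^infinity on the whole space: every iterated partial derivative (in any
   order) is differentiable at every point. *)
Definition smooth (R : realType) (n : nat) (f : 'rV[R]_n.+1 -> R) : Prop :=
  forall (s : seq 'I_n.+1) (p : 'rV[R]_n.+1),
    differentiable (foldr (@partial R n) f s) p.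

Definition vec3 (R : realType) (a b c : R) : 'rV[R]_3 :=
  \row_j [:: a; b; c]`_j.

(* A metric on R^3 is given by its matrix of components in the Cartesian
   coordinates (x, y, z), so that smoothness includes the axis x = y = 0. *)
Definition riemannian_metric (R : realType) (G : 'rV[R]_3 -> 'M[R]_3) : Prop :=
  [/\ forall i j : 'I_3, smooth (fun p => G p i j),
      forall p, (G p)^T = G p
    & forall p (v : 'rV[R]_3), v != 0 -> 0 < (v *m G p *m v^T) 0 0].

(* Everywhere below, cylindrical coordinates are ordered (rho, z, phi). *)
Definition cyl_point (R : realType) (rho z phi : R) : 'rV[R]_3 :=
  vec3 (rho * cos phi) (rho * sin phi) z.

(* The rows are the Cartesian components of d/drho, d/dz and d/dphi, i.e. the
   partial derivatives of cyl_point. *)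
Definition cyl_frame (R : realType) (rho phi : R) : 'M[R]_3 :=
  \matrix_(i < 3)
    [:: vec3 (cos phi) (sin phi) 0;
        vec3 0 0 1;
        vec3 (- (rho * sin phi)) (rho * cos phi) 0]`_i.

Definition cyl_components (R : realType) (G : 'rV[R]_3 -> 'M[R]_3)
    (rho z phi : R) : 'M[R]_3 :=
  cyl_frame rho phi *m G (cyl_point rho z phi) *m (cyl_frame rho phi)^T.

(* e^(2 alpha - 2 u) (drho^2 + dz^2)
   + rho^2 e^(-2 u) (dphi + B drho + A dz)^2 *)
Definition axisymmetric_form (R : realType) (alpha u A B : R -> R -> R)
    (rho z : R) : 'M[R]_3 :=
  let theta := vec3 (B rho z) (A rho z) 1 in
  expR (2 * alpha rho z - 2 * u rho z) *: diag_mx (vec3 1 1 0)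
  + (rho ^+ 2 * expR (- (2 * u rho z))) *: (theta^T *m theta).

(* alpha, u, A and B are functions of (rho, z), used only for rho > 0.  There
   they are smooth, because G is smooth and positive definite. *)
Definition axisymmetric_metric (R : realType) (G : 'rV[R]_3 -> 'M[R]_3)
    (alpha u A B : R -> R -> R) : Prop :=
  riemannian_metric G /\
  forall rho z phi : R, 0 < rho ->
    cyl_components G rho z phi = axisymmetric_form alpha u A B rho z.

(* d^(i+j) f / drho^i dz^j *)
Definition mixed_partial (R : realType) (i j : nat) (f : R -> R -> R)
    (rho z : R) : R :=
  derive1n i (fun s => derive1n j (f s) z) rho.

Definition decays (R : realType) (f : R -> R -> R) : Prop :=
  exists C r0 : R, 0 < r0 /\ forall (rho z : R) (i j : nat),
    let r := Num.sqrt (rho ^+ 2 + z ^+ 2) in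
    0 < rho -> r0 <= r -> (i + j <= 2)%N ->
    `|mixed_partial i j f rho z| <= C / r ^+ (1 + (i + j)).

Definition asymptotically_flat (R : realType) (alpha u A B : R -> R -> R) :
    Prop :=
  [/\ decays u, decays alpha, decays A & decays B].

Definition metric_norm (R : realType) (g : 'M[R]_3) (v : 'rV[R]_3) : R :=
  Num.sqrt ((v *m g *m v^T) 0 0).

(* The vector dual to the covector w, i.e. with components g^(ij) w_i. *)
Definition sharp (R : realType) (g : 'M[R]_3) (w : 'rV[R]_3) : 'rV[R]_3 :=
  w *m invmx g.

(* |eta|_g / |grad rho|_g, where eta = d/dphi. *)
Definition norm_ratio (R : realType) (G : 'rV[R]_3 -> 'M[R]_3)
    (rho z phi : R) : R :=
  let g := cyl_components G rho z phi in
  let eta := vec3 0 0 1 in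
  let grad_rho := sharp g (vec3 1 0 0) in
  metric_norm g eta / metric_norm g grad_rho.

(* For an axisymmetric metric, norm_ratio does not depend on phi. *)
Definition radially_monotone (R : realType) (G : 'rV[R]_3 -> 'M[R]_3) : Prop :=
  forall rho z phi : R, 0 < rho ->
    derive1 (fun s => s^-1 * norm_ratio G s z phi) rho <= 0.

Definition area_enlarging (R : realType) (G : 'rV[R]_3 -> 'M[R]_3) : Prop :=
  forall rho z phi : R, 0 < rho -> rho <= norm_ratio G rho z phi.

(* Main.v *)
Require Import Defs.
From mathcomp Require Import all_boot all_order all_algebra.
From mathcomp Require Import all_classical all_reals all_analysis.
From mathcomp Require Import ring lra.

(** In cylindrical components [|eta| / |grad rho| = rho e^(alpha - 2u)], so radial
    monotonicity makes [e^(alpha - 2u)] nonincreasing in [rho], and asymptotic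
    flatness makes it tend to 1 as [rho] grows at fixed [z]; hence it is at
    least 1. The only regularity used is that [e^(alpha - 2u)] is differentiable
    in [rho], which has to be extracted from the smoothness of the Cartesian
    components of the metric: [(rho e^(alpha - 2u))^2 = g_zz g_phiphi - g_zphi^2]. *)

Set Implicit Arguments.
Unset Strict Implicit.
Unset Printing Implicit Defensive.
Import Order.TTheory GRing.Theory Num.Theory.
Import numFieldNormedType.Exports.
Local Open Scope ring_scope.

Lemma axisymmetric_formE (R : realType) (alpha u A B : R -> R -> R)
    (rho z : R) (i j : 'I_3) :
  let theta := [:: B rho z; A rho z; 1] in
  axisymmetric_form alpha u A B rho z i j =
    expR (2 * alpha rho z - 2 * u rho z) * ((i < 2)%N && (i == j))%:R
    + rho ^+ 2 * expR (- (2 * u rho z)) * (theta`_i * theta`_j).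
Proof.
rewrite /axisymmetric_form !mxE big_ord1 !mxE; congr (_ * _ + _).
by case: i => [[|[|[|i]]] Hi] //=; case: eqP.
Qed.

Lemma axisymmetric_form_unit (R : realType) (alpha u A B : R -> R -> R)
    (rho z : R) :
  0 < rho -> axisymmetric_form alpha u A B rho z \in unitmx.
Proof.
move=> rho0.
pose E := expR (2 * alpha rho z - 2 * u rho z).
pose F := rho ^+ 2 * expR (- (2 * u rho z)).
pose a := A rho z; pose b := B rho z.
have E0 : E != 0 by rewrite gt_eqF ?expR_gt0.
have F0 : F != 0 by rewrite mulf_neq0 ?expf_neq0 ?gt_eqF ?expR_gt0.
(* The vectors [d_rho - b d_phi], [d_z - a d_phi], [d_phi] are orthogonal with squared norms [E],
   [E], [F]; [N] is the sum of their tensor squares divided by these norms. *)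
pose N : 'M[R]_3 := \matrix_(i < 3)
  [:: vec3 E^-1 0 (- b / E); vec3 0 E^-1 (- a / E);
      vec3 (- b / E) (- a / E) ((a ^+ 2 + b ^+ 2) / E + F^-1)]`_i.
suff /mulmx1_unit[] : axisymmetric_form alpha u A B rho z *m N = 1%:M by [].
apply/matrixP => i j; rewrite mxE !big_ord_recr big_ord0.
rewrite !axisymmetric_formE !mxE -/E -/F -/a -/b.
by case: i => [[|[|[|i]]] Hi] //=; case: j => [[|[|[|j]]] Hj] //=;
  rewrite ?mxE /=; field; rewrite ?E0 ?F0.
Qed.

(** The gradient of [rho] is [E^-1 (d_rho - B d_phi)], of squared norm [E^-1], while [|eta|^2 = F],
    so the ratio is the square root of [E F = rho^2 e^(2 alpha - 4 u)]. *)
Lemma norm_ratioE (R : realType) (G : 'rV[R]_3 -> 'M[R]_3)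
    (alpha u A B : R -> R -> R) (rho z phi : R) :
  axisymmetric_metric G alpha u A B -> 0 < rho ->
  norm_ratio G rho z phi = rho * expR (alpha rho z - 2 * u rho z).
Proof.
move=> [_ Gax] rho0; rewrite /norm_ratio (Gax _ _ _ rho0).
set g := axisymmetric_form _ _ _ _ _ _.
pose E := expR (2 * alpha rho z - 2 * u rho z).
have E0 : E != 0 by rewrite gt_eqF ?expR_gt0.
(* Checked after multiplication by the invertible matrix [g], so that [invmx] is never expanded. *)
have -> : sharp g (vec3 1 0 0) = vec3 E^-1 0 (- B rho z / E).
  rewrite /sharp -[RHS](mulmxK (axisymmetric_form_unit alpha u A B z rho0)).
  congr (_ *m _); apply/rowP => j.
  rewrite !mxE !big_ord_recr big_ord0 !axisymmetric_formE !mxE -/E.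
  by case: j => [[|[|[|j]]] Hj] //=; field.
have normE v : metric_norm g v = Num.sqrt
    (\sum_i \sum_j v 0 i * g i j * v 0 j).
  rewrite /metric_norm mxE exchange_big; congr Num.sqrt; apply: eq_bigr => i _.
  by rewrite !mxE mulr_suml.
rewrite !normE !big_ord_recr !big_ord0 !axisymmetric_formE !mxE /= -/E.
have sqrt_expR x : Num.sqrt (expR (2 * x)) = expR x.
  by rewrite expRM_natl sqrtr_sqr ger0_norm ?expR_ge0.
set F := rho ^+ 2 * _.
rewrite [X in Num.sqrt X / _](_ : _ = (rho * expR (- u rho z)) ^+ 2); last first.
  by rewrite exprMn -expRM_natl mulrN /F; ring.
rewrite [X in _ / Num.sqrt X](_ : _ = E^-1); last by field.
rewrite sqrtrV ?expR_ge0 // invrK sqrtr_sqr.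
rewrite ger0_norm ?mulr_ge0 ?expR_ge0 ?ltW //.
rewrite /E -mulrBr sqrt_expR -mulrA -expRD; congr (_ * expR _); ring.
Qed.

(** This is the Gram determinant of [d_z] and [d_phi]: the terms in [A] cancel. Being polynomial in
    the components, it inherits their differentiability. *)
Lemma sub_sqr_axisymmetric_form (R : realType) (alpha u A B : R -> R -> R)
    (rho z : R) (g := axisymmetric_form alpha u A B rho z) :
  g 1 1 * g 2%:R 2%:R - g 1 2%:R ^+ 2 =
    (rho * expR (alpha rho z - 2 * u rho z)) ^+ 2.
Proof.
rewrite /g !axisymmetric_formE /=.
rewrite exprMn -expRM_natl mulr1 mulr0 add0r.
have -> : 2 * (alpha rho z - 2 * u rho z) =
  (2 * alpha rho z - 2 * u rho z) - 2 * u rho z by ring.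
rewrite [RHS]mulrC [in RHS]expRD; ring.
Qed.

Lemma derivable_affine (R : realType) (n : nat) (f : 'rV[R]_n.+1 -> R)
    (a b : 'rV[R]_n.+1) (s : R) :
  differentiable f (s *: a + b) -> derivable (fun t : R => f (t *: a + b)) s 1.
Proof.
move=> df; rewrite /derivable (_ : (fun h => _) = (fun h => h^-1 *:
    ((f \o shift (s *: a + b)) (h *: a) - f (s *: a + b)))).
  exact: diff_derivable.
by apply/funext => h /=; rewrite -[h *: 1]/(h * 1) mulr1 scalerDl addrA.
Qed.

Lemma derivable_cyl_components (R : realType) (G : 'rV[R]_3 -> 'M[R]_3)
    (z phi s : R) (i j : 'I_3) :
  (forall i j : 'I_3, smooth (fun p => G p i j)) ->
  derivable (fun t => cyl_components G t z phi i j) s 1.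
Proof.
move=> Gsmooth.
have dG k l : derivable (fun t => G (cyl_point t z phi) k l) s 1.
  (* At fixed [z] and [phi], varying [rho] traces a straight Cartesian line. *)
  pose a := vec3 (cos phi) (sin phi) 0; pose b := vec3 0 0 z.
  have cylE t : cyl_point t z phi = t *: a + b.
    apply/rowP => m; rewrite !mxE.
    by case: m => [[|[|[|m]]] Hm] //=; ring.
  under eq_fun do rewrite cylE.
  exact: (@derivable_affine _ _ (fun p => G p k l) a b s (Gsmooth k l [::] _)).
have dframe k l : derivable (fun t => cyl_frame t phi k l) s 1.
  (* Each frame entry is affine in [t], hence determined by its values at 0 and 1. *)
  have frameE t : cyl_frame t phi k l =
      t * (cyl_frame 1 phi k l - cyl_frame 0 phi k l) + cyl_frame 0 phi k l.
    by case: k => [[|[|[|k]]] Hk] //; case: l => [[|[|[|l]]] Hl] //;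
      rewrite !mxE /= ?mxE /=; ring.
  under eq_fun do rewrite frameE.
  by apply: derivableD => //; apply: derivableM.
have dsum (F : 'I_3 -> R -> R) : (forall k, derivable (F k) s 1) ->
    derivable (fun t => \sum_k F k t) s 1.
  move=> dF; rewrite (_ : (fun t => _) = \sum_k F k); first exact: derivable_sum.
  by apply/funext => t; rewrite fct_sumE.
rewrite /cyl_components.
under eq_fun do rewrite mxE.
apply: (dsum (fun k t => (cyl_frame t phi *m G (cyl_point t z phi)) i k *
  (cyl_frame t phi)^T k j)) => k; apply: derivableM.
  under eq_fun do rewrite mxE.
  apply: (dsum (fun l t => cyl_frame t phi i l * G (cyl_point t z phi) l k)).
  by move=> l; apply: derivableM.
under eq_fun do rewrite mxE.
exact: dframe.
Qed.

Lemma radial_antitone (R : realType) (G : 'rV[R]_3 -> 'M[R]_3)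
    (alpha u A B : R -> R -> R) (z rho s : R) :
  axisymmetric_metric G alpha u A B -> radially_monotone G ->
  0 < rho -> rho <= s ->
  expR (alpha s z - 2 * u s z) <= expR (alpha rho z - 2 * u rho z).
Proof.
move=> Gax Gmono rho0 rhos.
pose g t := cyl_components G t z 0.
pose h t := t^-1 * norm_ratio G t z 0.
have hE t : 0 < t -> h t = expR (alpha t z - 2 * u t z).
  by move=> t0; rewrite /h (norm_ratioE _ _ Gax) // mulKf ?gt_eqF.
(* The sign of [derive1] yields monotonicity only once [h] is known to be derivable. Here [h] is
   [t^-1] times the square root of [q], and [q] is positive. *)
have dh t : 0 < t -> derivable h t 1.
  move=> t0; pose q x := g x 1 1 * g x 2%:R 2%:R - g x 1 2%:R ^+ 2.
  have qE x : 0 < x -> q x = norm_ratio G x z 0 ^+ 2.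
    move=> x0; rewrite (norm_ratioE _ _ Gax) // -(sub_sqr_axisymmetric_form _ _ A B).
    by rewrite /q /g Gax.2.
  have dg i j : derivable (fun x => g x i j) t 1.
    by apply: derivable_cyl_components; case: Gax => -[].
  have dq : derivable q t 1.
    rewrite /q; under eq_fun do rewrite expr2.
    exact: derivableB (derivableM (dg _ _) (dg _ _)) (derivableM (dg _ _) (dg _ _)).
  have q0 : 0 < q t.
    by rewrite qE // (norm_ratioE _ _ Gax) // exprn_gt0 // mulr_gt0 ?expR_gt0.
  have dsq : derivable (fun x : R => x^-1 * Num.sqrt (q x)) t 1.
    apply: derivableM.
      by apply: derivableV; rewrite ?gt_eqF.
    by case: (is_derive1_comp (is_derive1_sqrt q0) (derivableP dq)).
  (* The two functions are compared only where [x > 0], which holds near [t]. *)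
  apply: near_eq_derivable dsq.
  near=> x.
  have x0 : 0 < x by near: x; exact: lt_nbhsr.
  rewrite qE // sqrtr_sqr ger0_norm // (norm_ratioE _ _ Gax) //.
  by rewrite mulr_ge0 ?expR_ge0 ?ltW.
rewrite -!hE //; last exact: lt_le_trans rhos.
apply: (@ler0_derive1_nincr _ h rho s) => //.
- move=> x; rewrite in_itv /= => /andP[rx _]; apply: dh; exact: lt_trans rx.
- move=> x; rewrite in_itv /= => /andP[rx _]; apply: Gmono; exact: lt_trans rx.
apply: derivable_within_continuous => x; rewrite in_itv /= => /andP[rx _].
apply: dh; exact: lt_le_trans rx.
Unshelve. all: by end_near.
Qed.

(** Since [r >= rho], decay in [r] gives decay in [rho], uniformly in [z]. Taking [|C|] makes the
    constant nonnegative, as enlarging [1/r] to [1/rho] requires. *)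
Lemma decays_bound (R : realType) (f : R -> R -> R) :
  decays f -> exists C s0 : R, [/\ 0 < s0, 0 <= C &
    forall rho z, s0 <= rho -> `|f rho z| <= C / rho].
Proof.
move=> [C [r0 [r00 Cf]]]; exists `|C|, r0; split=> // rho z r0rho.
have rho0 : 0 < rho by exact: lt_le_trans r0rho.
have rhor : rho <= Num.sqrt (rho ^+ 2 + z ^+ 2).
  rewrite -[leLHS](gtr0_norm rho0) -sqrtr_sqr.
  by rewrite ler_sqrt ?lerDl ?addr_ge0 ?sqr_ge0.
have := Cf rho z 0 0 rho0 (le_trans r0rho rhor) isT.
rewrite /mixed_partial /= expr1 => /le_trans; apply.
rewrite (le_trans (ler_wpM2r _ (ler_norm C))) ?invr_ge0 ?sqrtr_ge0 //.
by rewrite ler_wpM2l // lef_pV2 ?posrE // (lt_le_trans rho0).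
Qed.

Theorem propositionA2 (R : realType) (G : 'rV[R]_3 -> 'M[R]_3)
    (alpha u A B : R -> R -> R) :
  axisymmetric_metric G alpha u A B ->
  asymptotically_flat alpha u A B ->
  radially_monotone G ->
  area_enlarging G.
Proof.
move=> Gax [/decays_bound[Cu [su [su0 Cu0 uC]]]
  /decays_bound[Ca [sa [sa0 Ca0 aC]]] _ _] Gmono rho z phi rho0.
rewrite (norm_ratioE _ _ Gax) // ler_pMr //.
apply/ler_addgt0Pr => e e0.
(* Far out, [|alpha - 2 u| <= K / s]. The radius [s] exceeds [rho] and both decay thresholds, and
   its term [K / e] forces [K / s <= e]. *)
pose K := Ca + 2 * Cu.
pose s := rho + su + sa + K / e.
have Ke0 : 0 <= K / e by rewrite divr_ge0 ?(ltW e0) // addr_ge0 // mulr_ge0.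
have s0 : 0 < s by rewrite /s; lra.
have rhos : rho <= s by rewrite /s; lra.
rewrite -lerBlDr (le_trans _ (radial_antitone z Gax Gmono rho0 rhos)) //.
(* By [1 + x <= e^x], it suffices that [alpha - 2 u >= -e] at radius [s]. *)
rewrite (le_trans _ (expR_ge1Dx _)) // lerD2l.
have /(uC s z) : su <= s by rewrite /s; lra.
have /(aC s z) : sa <= s by rewrite /s; lra.
rewrite !ler_norml => /andP[Ha _] /andP[_ Hu].
have : K / s <= e.
  by rewrite ler_pdivrMr // mulrC -ler_pdivrMr // /s; lra.
rewrite /K mulrDl -mulrA; lra.
Qed.
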